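(* Let $ML^n_p=(J^1(T,M),L)$ be a metrical multi-time Lagrange space with respect to the semi-Riemannian metric $h$ on $T$, with gravitational $h$-potential $G$, stress-energy d-tensor $\mathcal T$ and Einstein equations $Ric(C\Gamma)-\frac{Sc(C\Gamma)}2G=\mathcal K\mathcal T$. Then the conservation laws $\mathcal T^B_{A\vert B}=0$ (for all adapted indices $A$) of the Einstein equations are given by the formulas: (i) for $p=\dim T=1$, $$\left[\frac{R+S}2\right]_{/1}=R^m_{1\vert m}-P^{(m)}_{(1)1}\vert^{(1)}_{(m)},\qquad \left[R^m_j-\frac{R+S}2\delta^m_j\right]_{\vert m}=-P^{(m)}_{(1)j}\vert^{(1)}_{(m)},$$ $$\left[S^{(m)(1)}_{(1)(j)}-\frac{R+S}2\delta^m_j\right]\Big\vert^{(1)}_{(m)}=-P^{m(1)}_{\;\;\;(j)\vert m},$$ where $R^i_1=g^{im}R_{m1}$, $P^{(i)}_{(1)1}=h_{11}g^{im}P^{(1)}_{(m)1}$, $R^i_j=g^{im}R_{mj}$, $P^{(i)}_{(1)j}=h_{11}g^{im}P^{(1)}_{(m)j}$, $P^{i(1)}_{\;\;(j)}=g^{im}P^{\;\;(1)}_{m(j)}$ and $S^{(i)(1)}_{(1)(j)}=h_{11}g^{im}S^{(1)(1)}_{(m)(j)}$; (ii) for $p\ge2$, $$\left[H^\mu_\beta-\frac{H+R}2\delta^\mu_\beta\right]_{/\mu}=-R^m_{\beta\vert m},\qquad\left[R^m_j-\frac{H+R}2\delta^m_j\right]_{\vert m}=0,$$ where $H^\mu_\beta=h^{\mu\gamma}H_{\gamma\beta}$,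 $R^i_j=g^{im}R_{mj}$ and $R^i_\beta=g^{im}R_{m\beta}$.
   Context: **Space.** $T$ (dimension $p$, coordinates $t^\alpha$) and $M$ (dimension $n$, coordinates $x^i$) are smooth real manifolds; $E=J^1(T,M)\to T\times M$ is the first-order jet bundle with induced coordinates $(t^\alpha,x^i,x^i_\alpha)$. Greek indices run over $1,\dots,p$, Latin over $1,\dots,n$; repeated indices are summed. If $p=1$ write $t=t^1$, $y^i=x^i_1$. $h=(h_{\alpha\beta}(t))$ is a fixed semi-Riemannian metric on $T$ with inverse $(h^{\alpha\beta})$ and Christoffel symbols $H^\gamma_{\alpha\beta}=\frac{h^{\gamma\eta}}2\left(\frac{\partial h_{\eta\alpha}}{\partial t^\beta}+\frac{\partial h_{\eta\beta}}{\partial t^\alpha}-\frac{\partial h_{\alpha\beta}}{\partial t^\eta}\right)$. A metrical multi-time Lagrange space $ML^n_p=(J^1(T,M),L)$ is given by a smooth $L:E\to\mathbb R$ that is Kronecker $h$-regular: $G^{(\alpha)(\beta)}_{(i)(j)}:=\frac12\frac{\partial^2L}{\partial x^i_\alpha\partial x^j_\beta}=h^{\alpha\beta}g_{ij}$, with $g_{ij}$ a symmetric d-tensor (distinguished tensor) on $E$ of rank $n$ and constant signature, with inverse $g^{ij}$. For $p\ge2$ it is known that then $g_{ij}=g_{ij}(t,x)$ and $L=h^{\alpha\beta}(t)g_{ij}(t,x)x^i_\alpha x^j_\beta+U^{(\alpha)}_{(i)}(t,x)x^i_\alpha+F(t,x)$; put $U^{(\beta)}_{(k)j}=\frac{\partial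 U^{(\beta)}_{(k)}}{\partial x^j}-\frac{\partial U^{(\beta)}_{(j)}}{\partial x^k}$. **Canonical nonlinear connection** $\Gamma=(M^{(i)}_{(\alpha)\beta},N^{(i)}_{(\alpha)j})$: $M^{(i)}_{(\alpha)\beta}=-H^\gamma_{\alpha\beta}x^i_\gamma$. For $p=1$: $N^{(i)}_{(1)j}=h_{11}\frac{\partial\mathcal G^i}{\partial y^j}$ with $\mathcal G^i=\frac{g^{ik}}4\left(\frac{\partial^2L}{\partial x^j\partial y^k}y^j-\frac{\partial L}{\partial x^k}+\frac{\partial^2L}{\partial t\partial y^k}+\frac{\partial L}{\partial y^k}H^1_{11}+2h^{11}H^1_{11}g_{kl}y^l\right)$. For $p\ge2$: $N^{(i)}_{(\alpha)j}=\Gamma^i_{jk}x^k_\alpha+\frac{g^{ik}}2\frac{\partial g_{jk}}{\partial t^\alpha}+\frac{g^{ik}}4h_{\alpha\beta}U^{(\beta)}_{(k)j}$, with $\Gamma^i_{jk}=\frac{g^{im}}2\left(\frac{\partial g_{mj}}{\partial x^k}+\frac{\partial g_{mk}}{\partial x^j}-\frac{\partial g_{jk}}{\partial x^m}\right)$. Adapted basis $(X_A)$: $X_\alpha=\frac{\delta}{\delta t^\alpha}=\frac{\partial}{\partial t^\alpha}-M^{(j)}_{(\beta)\alpha}\frac{\partial}{\partial x^j_\beta}$, $X_i=\frac{\delta}{\delta x^i}=\frac{\partial}{\partial x^i}-N^{(j)}_{(\beta)i}\frac{\partial}{\partial x^j_\beta}$, and $\frac{\partial}{\partial x^i_\alpha}$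 (index ${}^{(\alpha)}_{(i)}$); dual vertical forms $\delta x^i_\alpha=dx^i_\alpha+M^{(i)}_{(\alpha)\beta}dt^\beta+N^{(i)}_{(\alpha)j}dx^j$. **Cartan canonical connection** $C\Gamma=(H^\gamma_{\alpha\beta},G^k_{j\gamma},L^i_{jk},C^{i(\gamma)}_{j(k)})$: $G^k_{j\gamma}=\frac{g^{ki}}2\frac{\delta g_{ij}}{\delta t^\gamma}$, $L^i_{jk}=\frac{g^{im}}2\left(\frac{\delta g_{mj}}{\delta x^k}+\frac{\delta g_{mk}}{\delta x^j}-\frac{\delta g_{jk}}{\delta x^m}\right)$, $C^{i(\gamma)}_{j(k)}=\frac{g^{im}}2\left(\frac{\partial g_{mj}}{\partial x^k_\gamma}+\frac{\partial g_{mk}}{\partial x^j_\gamma}-\frac{\partial g_{jk}}{\partial x^m_\gamma}\right)$. It is the linear connection $\nabla$ on $E$ with: $\nabla_{\delta/\delta t^\gamma}$ sending $\frac{\delta}{\delta t^\alpha}\mapsto H^\mu_{\alpha\gamma}\frac{\delta}{\delta t^\mu}$, $\frac{\delta}{\delta x^i}\mapsto G^k_{i\gamma}\frac{\delta}{\delta x^k}$, $\frac{\partial}{\partial x^i_\alpha}\mapsto(\delta^\alpha_\mu G^k_{i\gamma}-\delta^k_iH^\alpha_{\mu\gamma})\frac{\partial}{\partial x^k_\mu}$; $\nabla_{\delta/\delta x^j}$ sending $\frac{\delta}{\delta t^\alpha}\mapsto0$, $\frac{\delta}{\delta x^i}\mapsto L^k_{ij}\frac{\delta}{\delta x^k}$,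 $\frac{\partial}{\partial x^i_\alpha}\mapsto L^k_{ij}\frac{\partial}{\partial x^k_\alpha}$; $\nabla_{\partial/\partial x^j_\gamma}$ sending $\frac{\delta}{\delta t^\alpha}\mapsto0$, $\frac{\delta}{\delta x^i}\mapsto C^{k(\gamma)}_{i(j)}\frac{\delta}{\delta x^k}$, $\frac{\partial}{\partial x^i_\alpha}\mapsto C^{k(\gamma)}_{i(j)}\frac{\partial}{\partial x^k_\alpha}$. The corresponding covariant derivatives of d-tensor components are: ${}_{/\gamma}$ (along $\frac{\delta}{\delta t^\gamma}$), with corrections $+G^i_{m\gamma}$ / $-G^m_{i\gamma}$ on upper/lower spatial indices and $+H^\alpha_{\mu\gamma}$ / $-H^\mu_{\alpha\gamma}$ on upper/lower temporal indices; ${}_{\vert k}$ (along $\frac{\delta}{\delta x^k}$), with corrections $+L^i_{mk}$ / $-L^m_{ik}$ on spatial indices only; $\vert^{(\gamma)}_{(k)}$ (along $\frac{\partial}{\partial x^k_\gamma}$), with corrections $+C^{i(\gamma)}_{m(k)}$ / $-C^{m(\gamma)}_{i(k)}$ on spatial indices only. A paired index ${}^{(i)}_{(\alpha)}$ or ${}^{(\alpha)}_{(i)}$ counts as one spatial and one temporal index. **Curvature, Ricci, scalar curvature.** $\mathbf R(X,Y)Z=\nabla_X\nabla_YZ-\nabla_Y\nabla_XZ-\nabla_{[X,Y]}Z$, $\mathbf R(X_C,X_B)X_A=R^D_{ABC}X_D$, $R_{AB}=Ric(X_A,X_B)=R^D_{ABD}$. Notation: $H_{\alpha\beta}=Ric(\frac{\delta}{\delta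 t^\alpha},\frac{\delta}{\delta t^\beta})$, $R_{i\alpha}=Ric(\frac{\delta}{\delta x^i},\frac{\delta}{\delta t^\alpha})$, $R_{ij}=Ric(\frac{\delta}{\delta x^i},\frac{\delta}{\delta x^j})$, $P^{\;(\alpha)}_{i(j)}=Ric(\frac{\delta}{\delta x^i},\frac{\partial}{\partial x^j_\alpha})$, $P^{(\alpha)}_{(i)j}=Ric(\frac{\partial}{\partial x^i_\alpha},\frac{\delta}{\delta x^j})$, $P^{(\alpha)}_{(i)\beta}=Ric(\frac{\partial}{\partial x^i_\alpha},\frac{\delta}{\delta t^\beta})$, $S^{(\alpha)(\beta)}_{(i)(j)}=Ric(\frac{\partial}{\partial x^i_\alpha},\frac{\partial}{\partial x^j_\beta})$; $H=h^{\alpha\beta}H_{\alpha\beta}$, $R=g^{ij}R_{ij}$, $S=h_{\alpha\beta}g^{ij}S^{(\alpha)(\beta)}_{(i)(j)}$. **Einstein equations and conservation laws.** The gravitational $h$-potential of $ML^n_p$ is $G=h_{\alpha\beta}dt^\alpha\otimes dt^\beta+g_{ij}dx^i\otimes dx^j+h^{\alpha\beta}g_{ij}\delta x^i_\alpha\otimes\delta x^j_\beta$; $Sc(C\Gamma)=G^{AB}R_{AB}$ with $(G^{AB})$ the inverse of $G$ in the adapted basis (blocks $h^{\alpha\beta}$, $g^{ij}$, $h_{\alpha\beta}g^{ij}$, zero otherwise). $\mathcal K$ is the Einstein constant and $\mathcal T$ is an intrinsic tensor of matter, a $(0,2)$ d-tensor on $E$ called the stress-energy d-tensor, with $\mathcal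 T_{AB}=\mathcal T(X_A,X_B)$. Put $\mathcal T^B_A=G^{BD}\mathcal T_{DA}$. The conservation laws, which the stress-energy d-tensor is required to verify, are $\mathcal T^B_{A\vert B}=0$ for every adapted index $A\in\{\alpha,i,{}^{(\alpha)}_{(i)}\}$, where $\mathcal T^B_{A\vert B}=\mathcal T^\mu_{A/\mu}+\mathcal T^m_{A\vert m}+\mathcal T^{(m)}_{(\mu)A}\vert^{(\mu)}_{(m)}$.
   Formalization: In the first formula of (i) the sign before the divergence of P^{(m)}_{(1)1} is + instead of the printed −, which is false under the given definitions; the converse (formulas imply conservation laws) is stated for nonzero Einstein constant K. *)

(* Defs.v *)
From HB Require Import structures.
From mathcomp Require Import all_boot all_order all_algebra.
From mathcomp Require Import all_classical all_reals all_analysis.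
Set Implicit Arguments.
Unset Strict Implicit.
Unset Printing Implicit Defensive.
Import Order.TTheory GRing.Theory Num.Theory.
Import numFieldNormedType.Exports.
Local Open Scope classical_set_scope.
Local Open Scope ring_scope.

(** ** Smooth maps and smooth manifolds *)

(* C^k on [D] (always an open set below): all iterated directional derivatives
   up to order k exist and are continuous at every point of [D]. *)
Fixpoint Ck_on (R : realType) (V W : normedModType R) (k : nat)
    (D : set V) (f : V -> W) : Prop :=
  (forall x, D x -> {for x, continuous f}) /\
  match k with
  | 0 => True
  | k'.+1 => forall v : V, (forall x, D x -> derivable f x v) /\
                           Ck_on k' D (fun x => 'D_v f x : W)
  end.

Definition smooth_on (R : realType) (V W : normedModType R)
    (D : set V) (f : V -> W) : Prop := forall k, Ck_on k D f.

(* Any smooth atlas is allowed, in particular the maximal one.  Outside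
   [mdom a] (resp. the image of [mdom a]) the values of [mphi a] (resp. of its
   inverse [mpsi a]) are irrelevant. *)
Record manifold (R : realType) (d : nat) := Manifold {
  mpoint :> topologicalType;
  mchart : Type;
  mdom : mchart -> set mpoint;
  mphi : mchart -> mpoint -> 'rV[R]_d;
  mpsi : mchart -> 'rV[R]_d -> mpoint;
  m_hausdorff : hausdorff_space mpoint;
  m_second_countable : @second_countable mpoint;
  m_cover : forall x : mpoint, exists a, mdom a x;
  m_open_dom : forall a, open (mdom a);
  m_open_range : forall a, open (mphi a @` mdom a);
  m_phiK : forall a x, mdom a x -> mpsi a (mphi a x) = x;
  m_phi_cont : forall a x, mdom a x -> {for x, continuous (mphi a)};
  m_psi_cont : forall a s, (mphi a @` mdom a) s -> {for s, continuous (mpsi a)};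
  m_smooth : forall a b,
    smooth_on (mphi a @` (mdom a `&` mdom b)) (mphi b \o mpsi a)
}.

Section ManifoldCharts.
Context (R : realType) (d : nat) (X : manifold R d).

Definition chart_range (a : mchart X) : set 'rV[R]_d := mphi a @` mdom a.

Definition chart_overlap (a b : mchart X) : set 'rV[R]_d :=
  mphi a @` (mdom a `&` mdom b).

Definition transition (a b : mchart X) : 'rV[R]_d -> 'rV[R]_d :=
  mphi b \o mpsi a.

(* entry (i, j) is the derivative of the i-th new coordinate along the
   j-th old one *)
Definition transition_jac (a b : mchart X) (s : 'rV[R]_d) : 'M[R]_d :=
  \matrix_(i, j) 'D_(delta_mx 0 j) (fun s' => transition a b s' 0 i) s.

End ManifoldCharts.

(* [A] is congruent to diag(1,..,1,-1,..,-1) with r entries equal to 1. *)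
Definition has_signature (R : realType) (d : nat) (A : 'M[R]_d) (r : nat) :=
  exists2 P : 'M[R]_d, P \in unitmx &
    A = P^T *m diag_mx (\row_(j < d) (if (j < r)%N then 1 else -1)) *m P.

Definition semi_riemannian (R : realType) (d : nat) (X : manifold R d)
    (h : mchart X -> 'rV[R]_d -> 'M[R]_d) : Prop :=
  [/\ forall a, smooth_on (chart_range a) (h a),
      forall a s, chart_range a s -> (h a s)^T = h a s,
      exists r, forall a s, chart_range a s -> has_signature (h a s) r &
      forall a b s, chart_overlap a b s ->
        h a s = (transition_jac a b s)^T *m h b (transition a b s)
                  *m transition_jac a b s].

(** ** The first-order jet bundle in induced coordinates *)

(* Coordinates (t, x, v) on J^1(T, M), with [v i a] standing for x^i_a. *)
Notation jcoord R p n := ('rV[R]_p * 'rV[R]_n * 'M[R]_(n, p))%type.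

(* Adapted indices: temporal a, spatial i, and vertical (i, a). *)
Notation aindex p n := ('I_p + 'I_n + 'I_n * 'I_p)%type.

Section Indices.
Context (p n : nat).
Definition it (a : 'I_p) : aindex p n := inl (inl a).
Definition ix (i : 'I_n) : aindex p n := inl (inr i).
Definition iv (ia : 'I_n * 'I_p) : aindex p n := inr ia.
End Indices.
Arguments it {p n}.
Arguments ix {p n}.
Arguments iv {p n}.

Section JetBundle.
Context (R : realType) (p n : nat) (T : manifold R p) (M : manifold R n).
Implicit Types (a : mchart T) (b : mchart M) (e : jcoord R p n).

Definition jet_dom a b : set (jcoord R p n) :=
  [set e | chart_range a e.1.1 /\ chart_range b e.1.2].

Definition jet_overlap a b a' b' : set (jcoord R p n) :=
  [set e | chart_overlap a a' e.1.1 /\ chart_overlap b b' e.1.2].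

Definition jet_change a b a' b' e : jcoord R p n :=
  (transition a a' e.1.1, transition b b' e.1.2,
   transition_jac b b' e.1.2 *m e.2
     *m transition_jac a' a (transition a a' e.1.1)).

(* Coefficients of the (a,b)-adapted basis in the (a',b')-adapted basis. *)
Definition frame_change a b a' b' (A B : aindex p n) e : R :=
  let Jt := transition_jac a a' e.1.1 in
  let Jt' := transition_jac a' a (transition a a' e.1.1) in
  let Jx := transition_jac b b' e.1.2 in
  match A, B with
  | inl (inl al), inl (inl be) => Jt be al
  | inl (inr i), inl (inr j) => Jx j i
  | inr (i, al), inr (j, be) => Jx j i * Jt' al be
  | _, _ => 0
  end.

Definition jet_function (f : mchart T -> mchart M -> jcoord R p n -> R) :=
  (forall a b, smooth_on (jet_dom a b) (f a b)) /\
  (forall a b a' b' e, jet_overlap a b a' b' e ->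
     f a b e = f a' b' (jet_change a b a' b' e)).

(* (0,2) d-tensors on J^1(T, M), given by their adapted components. *)
Definition dtensor02
    (W : mchart T -> mchart M -> aindex p n -> aindex p n -> jcoord R p n -> R) :=
  (forall a b A B, smooth_on (jet_dom a b) (W a b A B)) /\
  (forall a b a' b' A B e, jet_overlap a b a' b' e ->
     W a b A B e =
     \sum_C \sum_D frame_change a b a' b' A C e * frame_change a b a' b' B D e
                   * W a' b' C D (jet_change a b a' b' e)).

End JetBundle.

(** ** Geometry in one induced chart *)

Section Local.
Context (R : realType) (p n : nat).
Local Notation J := (jcoord R p n).
Local Notation I := (aindex p n).
Implicit Types (A B C D : I) (e : J) (f : J -> R).

Definition natural_dir A : J :=
  match A with
  | inl (inl a) => (delta_mx 0 a, 0, 0)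
  | inl (inr i) => (0, delta_mx 0 i, 0)
  | inr (i, a) => (0, 0, delta_mx i a)
  end.

Definition pd A f e : R := 'D_(natural_dir A) f e.

(* A vector field on the chart, by its components in the natural basis. *)
Definition vfield := I -> J -> R.

Definition act (X : vfield) f e : R := \sum_B X B e * pd B f e.

Definition bracket (X Y : vfield) : vfield :=
  fun B e => act X (Y B) e - act Y (X B) e.

Context (h : 'rV[R]_p -> 'M[R]_p) (L : J -> R) (g : J -> 'M[R]_n).

Definition hinv (t : 'rV[R]_p) : 'M[R]_p := invmx (h t).
Definition ginv e : 'M[R]_n := invmx (g e).

(* H^c_{ab} *)
Definition Hchr (c a b : 'I_p) (t : 'rV[R]_p) : R :=
  let dh (i j k : 'I_p) : R := 'D_(delta_mx 0 k) (fun s => h s i j) t in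
  \sum_(d < p) hinv t c d / 2 * (dh d a b + dh d b a - dh a b d).

(* M^{(i)}_{(a)b} *)
Definition Mconn (i : 'I_n) (a b : 'I_p) e : R :=
  - \sum_(c < p) Hchr c a b e.1.1 * e.2 i c.

(* The function G^i of the case p = 1, where [a] is the only temporal index. *)
Definition spray (a : 'I_p) (i : 'I_n) e : R :=
  \sum_(k < n) ginv e i k / 4 *
    (\sum_(j < n) pd (ix j) (pd (iv (k, a)) L) e * e.2 j a
     - pd (ix k) L e
     + pd (it a) (pd (iv (k, a)) L) e
     + pd (iv (k, a)) L e * Hchr a a a e.1.1
     + 2 * hinv e.1.1 a a * Hchr a a a e.1.1 * \sum_(l < n) g e k l * e.2 l a).

(* Gamma^i_{jk}, the spatial Christoffel symbols *)
Definition Gamma (i j k : 'I_n) e : R :=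
  \sum_(m < n) ginv e i m / 2 *
    (pd (ix k) (fun e' => g e' m j) e + pd (ix j) (fun e' => g e' m k) e
     - pd (ix m) (fun e' => g e' j k) e).

(* U^{(b)}_{(k)}(t,x): for p >= 2, L is a polynomial of degree 2 in v and this
   is the coefficient of v k b in its linear part. *)
Definition Ulin (b : 'I_p) (k : 'I_n) e : R := pd (iv (k, b)) L (e.1, 0).

(* U^{(b)}_{(k)j} *)
Definition Ucurl (b : 'I_p) (k j : 'I_n) e : R :=
  pd (ix j) (Ulin b k) e - pd (ix k) (Ulin b j) e.

(* N^{(i)}_{(a)j}; the else branch is the formula for p >= 2 *)
Definition Nconn (i : 'I_n) (a : 'I_p) (j : 'I_n) e : R :=
  if p == 1%N then h e.1.1 a a * pd (iv (j, a)) (spray a i) e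
  else \sum_(k < n) Gamma i j k e * e.2 k a
       + \sum_(k < n) ginv e i k / 2 * pd (it a) (fun e' => g e' j k) e
       + \sum_(k < n) ginv e i k / 4 * \sum_(b < p) h e.1.1 a b * Ucurl b k j e.

(* X_A, by its natural components *)
Definition frame A : vfield := fun B e =>
  match A, B with
  | inl (inl a), inl (inl b) => (a == b)%:R
  | inl (inl a), inr (j, b) => - Mconn j b a e
  | inl (inr i), inl (inr j) => (i == j)%:R
  | inl (inr i), inr (j, b) => - Nconn j b i e
  | inr ia, inr jb => (ia == jb)%:R
  | _, _ => 0
  end.

(* The dual basis (dt, dx, delta x): coefficient of the B-th natural
   differential in its A-th element. *)
Definition coframe_coef A B e : R :=
  match A, B with
  | inl (inl a), inl (inl b) => (a == b)%:R
  | inl (inr i), inl (inr j) => (i == j)%:R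
  | inr (i, a), inl (inl b) => Mconn i a b e
  | inr (i, a), inl (inr j) => Nconn i a j e
  | inr ia, inr jb => (ia == jb)%:R
  | _, _ => 0
  end.

Definition coframe A (X : vfield) e : R := \sum_B coframe_coef A B e * X B e.

(* G^k_{jc} *)
Definition Gcoef (k j : 'I_n) (c : 'I_p) e : R :=
  \sum_(i < n) ginv e k i / 2 * act (frame (it c)) (fun e' => g e' i j) e.

(* L^i_{jk} *)
Definition Lcoef (i j k : 'I_n) e : R :=
  \sum_(m < n) ginv e i m / 2 *
    (act (frame (ix k)) (fun e' => g e' m j) e
     + act (frame (ix j)) (fun e' => g e' m k) e
     - act (frame (ix m)) (fun e' => g e' j k) e).

(* C^{i(c)}_{j(k)} *)
Definition Ccoef (i j k : 'I_n) (c : 'I_p) e : R :=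
  \sum_(m < n) ginv e i m / 2 *
    (pd (iv (k, c)) (fun e' => g e' m j) e
     + pd (iv (j, c)) (fun e' => g e' m k) e
     - pd (iv (m, c)) (fun e' => g e' j k) e).

(* The Cartan canonical connection: coefficient of X_B in nabla_{X_C} X_A. *)
Definition conn C A B e : R :=
  match C, A, B with
  | inl (inl c), inl (inl a), inl (inl m) => Hchr m a c e.1.1
  | inl (inl c), inl (inr i), inl (inr k) => Gcoef k i c e
  | inl (inl c), inr (i, a), inr (k, m) =>
      (a == m)%:R * Gcoef k i c e - (k == i)%:R * Hchr a m c e.1.1
  | inl (inr j), inl (inr i), inl (inr k) => Lcoef k i j e
  | inl (inr j), inr (i, a), inr (k, m) => (a == m)%:R * Lcoef k i j e
  | inr (j, c), inl (inr i), inl (inr k) => Ccoef k i j c e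
  | inr (j, c), inr (i, a), inr (k, m) => (a == m)%:R * Ccoef k i j c e
  | _, _, _ => 0
  end.

Definition nabla (X Y : vfield) : vfield := fun B e =>
  \sum_D (act X (coframe D Y) e
          + \sum_C \sum_A coframe C X e * coframe A Y e * conn C A D e)
         * frame D B e.

Definition curv (X Y Z : vfield) : vfield := fun B e =>
  nabla X (nabla Y Z) B e - nabla Y (nabla X Z) B e - nabla (bracket X Y) Z B e.

(* R^D_{ABC} *)
Definition Rcomp D A B C e : R :=
  coframe D (curv (frame C) (frame B) (frame A)) e.

(* R_{AB} = Ric(X_A, X_B) *)
Definition Ric A B e : R := \sum_D Rcomp D A B D e.

Definition Hscal e : R :=
  \sum_(a < p) \sum_(b < p) hinv e.1.1 a b * Ric (it a) (it b) e.
Definition Rscal e : R :=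
  \sum_(i < n) \sum_(j < n) ginv e i j * Ric (ix i) (ix j) e.
Definition Sscal e : R :=
  \sum_(a < p) \sum_(b < p) \sum_(i < n) \sum_(j < n)
    h e.1.1 a b * ginv e i j * Ric (iv (i, a)) (iv (j, b)) e.

(* The gravitational h-potential and its inverse, in the adapted basis. *)
Definition Gpot A B e : R :=
  match A, B with
  | inl (inl a), inl (inl b) => h e.1.1 a b
  | inl (inr i), inl (inr j) => g e i j
  | inr (i, a), inr (j, b) => hinv e.1.1 a b * g e i j
  | _, _ => 0
  end.
Definition Gpot_inv A B e : R :=
  match A, B with
  | inl (inl a), inl (inl b) => hinv e.1.1 a b
  | inl (inr i), inl (inr j) => ginv e i j
  | inr (i, a), inr (j, b) => h e.1.1 a b * ginv e i j
  | _, _ => 0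
  end.

Definition Sc e : R := \sum_A \sum_B Gpot_inv A B e * Ric A B e.

(* Covariant derivative along X_C of components W with one upper index (of the
   kind embedded by [up]) and one lower index (of the kind embedded by [lo]).
   Since [conn] is block diagonal in (A, B), the corrections only involve
   indices of the same kind, and a vertical index gets one spatial and one
   temporal correction. *)
Definition covd (IU IL : finType) (up : IU -> I) (lo : IL -> I)
    (W : IU -> IL -> J -> R) C (u : IU) (l : IL) e : R :=
  act (frame C) (W u l) e
  + \sum_(k : IU) conn C (up k) (up u) e * W k l e
  - \sum_(k : IL) conn C (lo l) (lo k) e * W u k e.

(* T^B_A and T^B_{A|B} *)
Definition raise (W : I -> I -> J -> R) B A e : R :=
  \sum_D Gpot_inv B D e * W D A e.
Definition divergence (W : I -> I -> J -> R) A e : R :=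
  \sum_B covd id id (raise W) B B A e.

(* Ricci components with one index raised *)

(* H^m_b *)
Definition H_tt (m b : 'I_p) e : R :=
  \sum_(c < p) hinv e.1.1 m c * Ric (it c) (it b) e.
(* R^i_b *)
Definition R_xt (i : 'I_n) (b : 'I_p) e : R :=
  \sum_(m < n) ginv e i m * Ric (ix m) (it b) e.
(* R^i_j *)
Definition R_xx (i j : 'I_n) e : R :=
  \sum_(m < n) ginv e i m * Ric (ix m) (ix j) e.
(* P^{i(b)}_{(j)} *)
Definition P_xv (i : 'I_n) (jb : 'I_n * 'I_p) e : R :=
  \sum_(m < n) ginv e i m * Ric (ix m) (iv jb) e.

(* The next three are used for p = 1, where mu takes the single value ia.2. *)
(* P^{(i)}_{(a)b} *)
Definition P_vt (ia : 'I_n * 'I_p) (b : 'I_p) e : R :=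
  \sum_(mu < p) h e.1.1 ia.2 mu * \sum_(m < n) ginv e ia.1 m * Ric (iv (m, mu)) (it b) e.
(* P^{(i)}_{(a)j} *)
Definition P_vx (ia : 'I_n * 'I_p) (j : 'I_n) e : R :=
  \sum_(mu < p) h e.1.1 ia.2 mu * \sum_(m < n) ginv e ia.1 m * Ric (iv (m, mu)) (ix j) e.
(* S^{(i)(b)}_{(a)(j)} *)
Definition S_vv (ia jb : 'I_n * 'I_p) e : R :=
  \sum_(mu < p) h e.1.1 ia.2 mu * \sum_(m < n) ginv e ia.1 m * Ric (iv (m, mu)) (iv jb) e.

(* Conservation laws for p = 1; [o] is the only temporal index. *)
Definition laws_p1 (o : 'I_p) e : Prop :=
  [/\ (* The last term carries the sign + , since T^B_{1|B} is the sum of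
         - [(R + S) / 2]_{/1} and of the two terms on the right. *)
      act (frame (it o)) (fun e' => (Rscal e' + Sscal e') / 2) e
      = \sum_(m < n) covd ix it R_xt (ix m) m o e
        + \sum_(m < n) covd iv it P_vt (iv (m, o)) (m, o) o e,
      forall j : 'I_n,
        \sum_(m < n) covd ix ix
          (fun m' j' e' => R_xx m' j' e' - (Rscal e' + Sscal e') / 2 * (m' == j')%:R)
          (ix m) m j e
        = - \sum_(m < n) covd iv ix P_vx (iv (m, o)) (m, o) j e &
      forall j : 'I_n,
        \sum_(m < n) covd iv iv
          (fun m' j' e' => S_vv m' j' e' - (Rscal e' + Sscal e') / 2 * (m' == j')%:R)
          (iv (m, o)) (m, o) (j, o) e
        = - \sum_(m < n) covd ix iv P_xv (ix m) m (j, o) e].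

(* Conservation laws for p >= 2. *)
Definition laws_p2 e : Prop :=
  (forall b : 'I_p,
     \sum_(mu < p) covd it it
       (fun m' b' e' => H_tt m' b' e' - (Hscal e' + Rscal e') / 2 * (m' == b')%:R)
       (it mu) mu b e
     = - \sum_(m < n) covd ix it R_xt (ix m) m b e) /\
  (forall j : 'I_n,
     \sum_(m < n) covd ix ix
       (fun m' j' e' => R_xx m' j' e' - (Hscal e' + Rscal e') / 2 * (m' == j')%:R)
       (ix m) m j e
     = 0).

End Local.

(** ** Metrical multi-time Lagrange spaces *)

(* L is a smooth function on J^1(T, M) that is Kronecker h-regular, with
   associated spatial d-tensor g. *)
Definition lagrange_space (R : realType) (p n : nat)
    (T : manifold R p) (M : manifold R n)
    (h : mchart T -> 'rV[R]_p -> 'M[R]_p)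
    (L : mchart T -> mchart M -> jcoord R p n -> R)
    (g : mchart T -> mchart M -> jcoord R p n -> 'M[R]_n) : Prop :=
  [/\ jet_function L,
      forall a b e, jet_dom a b e -> forall (i j : 'I_n) (al be : 'I_p),
        pd (iv (i, al)) (pd (iv (j, be)) (L a b)) e / 2
        = hinv (h a) e.1.1 al be * g a b e i j,
      (forall a b, smooth_on (jet_dom a b) (g a b)) /\
      (forall a b a' b' e, jet_overlap a b a' b' e ->
         g a b e = (transition_jac b b' e.1.2)^T
                     *m g a' b' (jet_change a b a' b' e)
                     *m transition_jac b b' e.1.2),
      forall a b e, jet_dom a b e -> (g a b e)^T = g a b e /\ \rank (g a b e) = n &
      exists r, forall a b e, jet_dom a b e -> has_signature (g a b e) r].

(* Main.v *)
Require Import Defs.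
From HB Require Import structures.
From mathcomp Require Import all_boot all_order all_algebra.
From mathcomp Require Import all_classical all_reals all_analysis.
From mathcomp Require Import ring.
Set Implicit Arguments.
Unset Strict Implicit.
Unset Printing Implicit Defensive.
Import Order.TTheory GRing.Theory Num.Theory.
Import numFieldNormedType.Exports.
Local Open Scope classical_set_scope.
Local Open Scope ring_scope.

(** Raising an index of the Einstein equations turns [K * T^B_A] into
    [Ric^B_A - Sc/2 delta^B_A], and the Cartan connection preserves the three
    kinds of adapted indices, so the divergence splits into one sum per kind.
    The temporal coefficients [H] depend on [t] only and brackets of adapted
    fields are vertical, whence [Ric(d/dt, X) = 0] unless [X] is temporal; for
    [p = 1] also [Ric(d/dt, d/dt) = 0] by antisymmetry.  For [p >= 2], the
    symmetry of the third vertical derivatives of [L] gives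
    [h^{ab} d_{kc} g_ij = h^{cb} d_{ia} g_kj]; contracting with [h_{ba}] for some
    [a <> c] shows that [g] is constant on the fibres.  Then every connection
    coefficient is constant on the fibres and the vertical ones vanish, so all
    Ricci components with a vertical index vanish, [Sc = H + R] is constant on
    the fibres, and the vertical conservation law is trivial. *)

(** * Directional derivatives *)

Section DirectionalDerivatives.
Context (R : realType) (V : normedModType R).
Implicit Types (f : V -> R) (x u v w : V).

(* No derivability is needed: where the limit does not exist, ['D_v f x] is [0]. *)
Lemma deriveZ_total f (c : R) x v : 'D_v (fun y => c * f y) x = c * 'D_v f x.
Proof.
have [->|c0] := eqVneq c 0.
  by rewrite mul0r (_ : (fun _ => _) = cst 0) ?derive_cst// funeqE => y; rewrite mul0r.
have [df|ndf] := pselect (derivable f x v).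
  by rewrite -[RHS]/(c *: 'D_v f x) -deriveZ.
have ndcf : ~ derivable (fun y => c * f y) x v.
  move=> dcf; apply: ndf.
  rewrite (_ : f = c^-1 *: (fun y => c * f y)); first exact: derivableZ.
  by rewrite funeqE => y; rewrite fctE /= [RHS]mulrA mulVf ?mul1r.
by rewrite /derive (dvgP ndf) (dvgP ndcf) mulr0.
Qed.

(** The difference quotient at [x] samples its function only on the line through [x] in direction
    [v]. The two limits are therefore literally the same expression, and neither needs to exist. *)
Lemma derive_eq_line f f' x v :
  (forall s : R, f (x + s *: v) = f' (x + s *: v)) -> 'D_v f x = 'D_v f' x.
Proof.
move=> ff'; rewrite /derive; set F := fun h => _; set F' := fun h => _.
have -> // : F = F'; rewrite funeqE => s; rewrite /F /F' /= !(addrC _ x) ff'.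
by have := ff' 0; rewrite scale0r addr0 => ->.
Qed.

Lemma derive_invariant f x v : (forall s : R, f (x + s *: v) = f x) -> 'D_v f x = 0.
Proof. by move=> fxv; rewrite (derive_eq_line (f' := cst (f x))) ?derive_cst. Qed.

Lemma derive_translate f x v w : 'D_v (fun y => f (y + w)) x = 'D_v f (x + w).
Proof.
rewrite /derive; set F := fun h => _; set F' := fun h => _.
by have -> : F = F' by rewrite funeqE => s; rewrite /F /F' /= addrA.
Qed.

(** This reduces directional derivatives to one-variable ones, so that the mean value theorem and
    the criterion for constancy on [R] apply. *)
Lemma is_derive_line f x v (s : R) :
  derivable f (x + s *: v) v ->
  is_derive s (1 : R) (fun r : R => f (x + r *: v)) ('D_v f (x + s *: v)).
Proof.
have eqq : (fun h : R => h^-1 *: (((fun r : R => f (x + r *: v)) \o shift s) (h *: 1) - f (x + s *: v)))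
         = (fun h : R => h^-1 *: ((f \o shift (x + s *: v)) (h *: v) - f (x + s *: v))).
  rewrite funeqE => h /=; congr (_ *: (f _ - _)).
  by rewrite [h *: 1]mulr1 scalerDl addrCA.
by move=> df; split; rewrite /derivable /derive eqq.
Qed.

(** The mean value theorem is applied twice to the second difference over a parallelogram: first in
    direction [u] to the [v]-increment of [f], then in direction [v] to ['D_u f]. *)
Lemma derive_MVT2 f x u v (r : R) : 0 < r ->
  (forall a b : R, 0 <= a <= r -> 0 <= b <= r ->
     derivable f (x + a *: u + b *: v) u /\
     derivable ('D_u f) (x + a *: u + b *: v) v) ->
  exists a, exists2 b, (0 <= a <= r) && (0 <= b <= r) &
    f (x + r *: u + r *: v) - f (x + r *: u) - f (x + r *: v) + f x
    = 'D_v ('D_u f) (x + a *: u + b *: v) * r * r.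
Proof.
move=> r0 df.
(* The second difference is [phi r - phi 0]. *)
pose phi (a : R) := f (x + r *: v + a *: u) - f (x + a *: u).
pose dphi (a : R) := 'D_u f (x + r *: v + a *: u) - 'D_u f (x + a *: u).
have dphiP a : 0 <= a <= r -> is_derive a (1 : R) phi (dphi a).
  move=> ar; apply: is_deriveB; apply: is_derive_line.
    by rewrite addrAC; apply: (df a r ar _).1; rewrite lexx ltW.
  by have := (df a 0 ar _).1; rewrite scale0r addr0; apply; rewrite lexx ltW.
have ophi a : a \in `]0, r[ -> is_derive a (1 : R) phi (dphi a).
  by rewrite in_itv /= => /andP[a0 ar]; apply: dphiP; rewrite !ltW.
have cphi : {within `[0, r], continuous phi}.
  apply: derivable_within_continuous => a; rewrite in_itv /= => ar.
  by have [] := dphiP a ar.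
have [a ar E1] := MVT r0 ophi cphi.
have {}ar : 0 <= a <= r by move: ar; rewrite in_itv /= => /andP[? ?]; rewrite !ltW.
(* At the intermediate point [a], the derivative [dphi a] is the increment [psi r - psi 0]. *)
pose psi (b : R) := 'D_u f (x + a *: u + b *: v).
pose dpsi (b : R) := 'D_v ('D_u f) (x + a *: u + b *: v).
have dpsiP b : 0 <= b <= r -> is_derive b (1 : R) psi (dpsi b).
  by move=> br; apply: is_derive_line; exact: (df a b ar br).2.
have opsi b : b \in `]0, r[ -> is_derive b (1 : R) psi (dpsi b).
  by rewrite in_itv /= => /andP[b0 br]; apply: dpsiP; rewrite !ltW.
have cpsi : {within `[0, r], continuous psi}.
  apply: derivable_within_continuous => b; rewrite in_itv /= => br.
  by have [] := dpsiP b br.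
have [b br E2] := MVT r0 opsi cpsi.
have {}br : 0 <= b <= r by move: br; rewrite in_itv /= => /andP[? ?]; rewrite !ltW.
exists a; exists b; first by rewrite ar br.
move: E1 E2; rewrite /phi /dphi /psi /dpsi !scale0r !addr0 !subr0 => E1 E2.
rewrite -E2 (addrAC x (a *: u)) -E1 (addrAC x (r *: v)).
by ring.
Qed.

(** Schwarz's theorem: one second difference, evaluated in both orders, equals each mixed derivative
    at some point near [x]. Continuity at [x] then forces the two values at [x] to be within any [e]
    of each other. *)
Lemma derive_comm f (D : set V) x u v : open D -> D x ->
  (forall y, D y -> [/\ derivable f y u, derivable f y v,
     derivable ('D_u f) y v & derivable ('D_v f) y u]) ->
  {for x, continuous ('D_v ('D_u f))} -> {for x, continuous ('D_u ('D_v f))} ->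
  'D_v ('D_u f) x = 'D_u ('D_v f) x.
Proof.
move=> oD Dx df cvu cuv; apply/eqP; rewrite -subr_eq0 -normr_le0.
apply/ler_addgt0Pr => e e0; rewrite add0r.
have e20 : 0 < e / 2 by rewrite divr_gt0.
have close (A B C : R) : `|A - C| < e / 2 -> `|B - C| < e / 2 -> `|A - B| <= e.
  move=> AC BC; rewrite (le_trans (ler_distD C _ _))// (splitr e) lerD ?ltW//.
  by rewrite distrC.
have : \forall y \near x, D y /\ `|'D_v ('D_u f) x - 'D_v ('D_u f) y| < e / 2
     /\ `|'D_u ('D_v f) x - 'D_u ('D_v f) y| < e / 2.
  apply: filterI; first exact: open_nbhs_nbhs.
  by apply: filterI; [move/cvgrPdist_lt : cvu => /(_ _ e20)
                     |move/cvgrPdist_lt : cuv => /(_ _ e20)].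
move=> /nbhs_ballP[d /= d0 dP].
(* With this side length the whole parallelogram lies within [d / 2] of [x]. The summand 1 keeps the
   denominator positive when [u] and [v] both vanish. *)
pose r := d / 2 / (`|u| + `|v| + 1).
have N0 : 0 < `|u| + `|v| + 1 by rewrite ltr_pwDr// addr_ge0.
have r0 : 0 < r by rewrite !divr_gt0.
have inball a b : 0 <= a <= r -> 0 <= b <= r -> ball x d (x + a *: u + b *: v).
  move=> /andP[a0 ar] /andP[b0 br]; rewrite -ball_normE /=.
  rewrite -addrA opprD addrA subrr add0r normrN (le_lt_trans (ler_normD _ _))//.
  rewrite !normrZ !ger0_norm//.
  apply: (@le_lt_trans _ _ (r * (`|u| + `|v| + 1))).
    rewrite !mulrDr mulr1 ler_wpDr ?(ltW r0)// lerD// ler_wpM2r//.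
  by rewrite divfK ?gt_eqF// ltr_pdivrMr// ltr_pMr// ltr1n.
have inballC a b : 0 <= a <= r -> 0 <= b <= r -> ball x d (x + a *: v + b *: u).
  by move=> ha hb; rewrite addrAC; exact: inball.
have hu a b : 0 <= a <= r -> 0 <= b <= r -> derivable f (x + a *: u + b *: v) u
    /\ derivable ('D_u f) (x + a *: u + b *: v) v.
  by move=> ar br; have [Dy _] := dP _ (inball a b ar br); have [] := df _ Dy.
have hv a b : 0 <= a <= r -> 0 <= b <= r -> derivable f (x + a *: v + b *: u) v
    /\ derivable ('D_v f) (x + a *: v + b *: u) u.
  by move=> ar br; have [Dy _] := dP _ (inballC a b ar br); have [] := df _ Dy.
have [a1 [b1 /andP[a1r b1r] E1]] := derive_MVT2 r0 hu.
have [a2 [b2 /andP[a2r b2r] E2]] := derive_MVT2 r0 hv.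
(* The second difference is symmetric in [u] and [v], and the factor [r * r] cancels. *)
have EE : 'D_v ('D_u f) (x + a1 *: u + b1 *: v) = 'D_u ('D_v f) (x + a2 *: v + b2 *: u).
  apply: (mulIf (lt0r_neq0 r0)); apply: (mulIf (lt0r_neq0 r0)).
  apply: etrans (esym E1) (etrans _ E2).
  by rewrite (addrAC x (r *: v)) [X in X + _ = _]addrAC.
have [_ [H1 _]] := dP _ (inball _ _ a1r b1r).
have [_ [_ H2]] := dP _ (inballC _ _ a2r b2r).
rewrite EE in H1.
exact: close H1 H2.
Qed.

End DirectionalDerivatives.

(** * Curvature in the adapted frame *)

Lemma sumr_delta (R : pzSemiRingType) (I : finType) (i : I) (F : I -> R) :
  \sum_j (i == j)%:R * F j = F i.
Proof.
rewrite (bigD1 i)//= eqxx mul1r big1 ?addr0// => j ji.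
by rewrite eq_sym (negbTE ji) mul0r.
Qed.

Lemma sumr_deltar (R : pzSemiRingType) (I : finType) (i : I) (F : I -> R) :
  \sum_j F j * (i == j)%:R = F i.
Proof.
rewrite (bigD1 i)//= eqxx mulr1 big1 ?addr0// => j ji.
by rewrite eq_sym (negbTE ji) mulr0.
Qed.

Lemma sum_aindex (V : nmodType) (p n : nat) (F : aindex p n -> V) :
  \sum_A F A = \sum_a F (it a) + \sum_i F (ix i) + \sum_v F (iv v).
Proof. by rewrite big_sumType big_sumType. Qed.

Section Frames.
Context (R : realType) (p n : nat).
Local Notation J := (jcoord R p n).
Local Notation I := (aindex p n).
Context (h : 'rV[R]_p -> 'M[R]_p) (L : J -> R) (g : J -> 'M[R]_n).
Implicit Types (A B C D : I) (e : J) (f : J -> R) (X Y Z : vfield R p n).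

Local Notation coframe := (coframe h L g).
Local Notation frame := (frame h L g).
Local Notation conn := (conn h L g).
Local Notation nabla := (nabla h L g).
Local Notation Rcomp := (Rcomp h L g).
Local Notation Ric := (Ric h L g).

Lemma coframe_it a X e : coframe (it a) X e = X (it a) e.
Proof.
rewrite /coframe sum_aindex /= sumr_delta [X in _ + X + _]big1
  ?[X in _ + X]big1 ?addr0// => *; exact: mul0r.
Qed.

Lemma coframe_ix i X e : coframe (ix i) X e = X (ix i) e.
Proof.
rewrite /coframe sum_aindex /= sumr_delta [X in X + _ + _]big1
  ?[X in _ + X]big1 ?addr0 ?add0r// => *; exact: mul0r.
Qed.

Lemma coframe_iv i a X e : coframe (iv (i, a)) X e =
  \sum_b Mconn h i a b e * X (it b) e + \sum_j Nconn h L g i a j e * X (ix j) e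
  + X (iv (i, a)) e.
Proof. by rewrite /coframe sum_aindex /= sumr_delta. Qed.

(** The terms in [Mconn] and [Nconn] of the vertical coframe cancel those of the horizontal frame
    fields. *)
Lemma coframe_frame A B e : coframe A (frame B) e = (A == B)%:R.
Proof.
case: A => [[a|i]|[i a]].
- rewrite coframe_it; case: B => [[b|j]|[j b]] //=.
  by congr (_%:R); rewrite eq_sym.
- rewrite coframe_ix; case: B => [[b|j]|[j b]] //=.
  by congr (_%:R); rewrite eq_sym.
rewrite coframe_iv; case: B => [[b|j]|[j b]] /=.
- under eq_bigr do rewrite mulrC.
  by rewrite sumr_delta [X in _ + X + _]big1 ?addr0 ?subrr// => *; exact: mulr0.
- under [X in _ + X + _]eq_bigr do rewrite mulrC.
  by rewrite sumr_delta big1 ?add0r ?subrr// => *; exact: mulr0.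
rewrite !big1 ?add0r => [|*|*]; [|exact: mulr0..].
by congr (_%:R); rewrite eq_sym.
Qed.

Lemma act_cst X c e : act X (fun=> c) e = 0.
Proof. by rewrite /act big1// => A _; rewrite /pd derive_cst mulr0. Qed.

Lemma coframe_sum_frame (w : I -> J -> R) D e :
  coframe D (fun B e' => \sum_C w C e' * frame C B e') e = w D e.
Proof.
rewrite /Defs.coframe; under eq_bigr do rewrite mulr_sumr.
rewrite exchange_big /=.
under eq_bigr => C _.
  under eq_bigr do rewrite mulrCA.
  rewrite -mulr_sumr -/(Defs.coframe h L g D (frame C) e) coframe_frame.
  over.
by rewrite sumr_deltar.
Qed.

Lemma coframe_nabla X Y D e :
  coframe D (nabla X Y) e =
  act X (coframe D Y) e
  + \sum_C \sum_A coframe C X e * coframe A Y e * conn C A D e.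
Proof. exact: (coframe_sum_frame (fun D e => _)). Qed.

Lemma coframe_nabla_frame B A D :
  coframe D (nabla (frame B) (frame A)) = conn B A D.
Proof.
rewrite funeqE => e; rewrite coframe_nabla.
rewrite (_ : coframe D (frame A) = fun=> (D == A)%:R) ?act_cst ?add0r; last first.
  by rewrite funeqE => e'; rewrite coframe_frame.
rewrite (bigD1 B)//= [X in _ + X]big1 ?addr0 => [|C /negbTE CB].
  under eq_bigr do rewrite !coframe_frame eqxx mul1r eq_sym.
  exact: sumr_delta.
by rewrite big1// => A' _; rewrite coframe_frame CB !mul0r.
Qed.

Lemma coframe_nabla_nabla C B A D e :
  coframe D (nabla (frame C) (nabla (frame B) (frame A))) e =
  act (frame C) (conn B A D) e + \sum_A' conn B A A' e * conn C A' D e.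
Proof.
rewrite coframe_nabla coframe_nabla_frame; congr (_ + _).
under eq_bigr => C' _.
  under eq_bigr => A' _ do rewrite coframe_frame coframe_nabla_frame eq_sym -mulrA.
  rewrite -mulr_sumr; over.
by rewrite sumr_delta.
Qed.

(** This is the curvature formula in a nonholonomic frame; the last sum accounts for the brackets.
    As [nabla] is given by its adapted components, iterating it calls for no Leibniz rule and hence
    no derivability. *)
Lemma RcompE D A B C e : Rcomp D A B C e =
  act (frame C) (conn B A D) e - act (frame B) (conn C A D) e
  + \sum_A' (conn B A A' e * conn C A' D e - conn C A A' e * conn B A' D e)
  - \sum_C' coframe C' (bracket (frame C) (frame B)) e * conn C' A D e.
Proof.
have coframeB X Y : coframe D (fun B e => X B e - Y B e) e = coframe D X e - coframe D Y e.
  by rewrite /Defs.coframe -sumrB; apply: eq_bigr => B' _; rewrite mulrBr.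
rewrite /Defs.Rcomp /curv !coframeB !coframe_nabla_nabla.
rewrite coframe_nabla (_ : coframe D (frame A) = fun=> (D == A)%:R) ?act_cst ?add0r; last first.
  by rewrite funeqE => e'; rewrite coframe_frame.
congr (_ - _); first by rewrite sumrB opprD addrACA.
apply: eq_bigr => C' _.
under eq_bigr => A' _ do rewrite coframe_frame mulrAC eq_sym mulrC.
by rewrite sumr_delta.
Qed.

(* The base components of the adapted frame are constant, so brackets of its members are vertical. *)
Lemma bracket_frame_vertical B C D e :
  (forall v, D <> iv v) -> coframe D (bracket (frame C) (frame B)) e = 0.
Proof.
case: D => [[a|i]|v] nv; last by have := nv v.
- rewrite coframe_it /bracket; have fr A : exists c, frame A (it a) = fun=> c.
    by case: A => [[b|j]|[j b]] /=; [exists (b == a)%:R|exists 0|exists 0].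
  have [c ->] := fr C; have [d ->] := fr B.
  by rewrite !act_cst subrr.
- rewrite coframe_ix /bracket; have fr A : exists c, frame A (ix i) = fun=> c.
    by case: A => [[b|j]|[j b]] /=; [exists 0|exists (j == i)%:R|exists 0].
  have [c ->] := fr C; have [d ->] := fr B.
  by rewrite !act_cst subrr.
Qed.

Lemma Rcomp_diag D A B e : Rcomp D A B B e = 0.
Proof.
rewrite RcompE subrr add0r sumrB subrr sub0r big1 ?oppr0// => C _.
rewrite (_ : bracket _ _ = fun _ _ => 0); last first.
  by rewrite funeqE => B'; rewrite funeqE => e'; rewrite /bracket subrr.
by rewrite /Defs.coframe big1 ?mul0r// => *; rewrite mulr0.
Qed.

(** This is the equivalence relation whose classes are the diagonal blocks of the connection. *)
Definition same_kind A B : bool :=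
  match A, B with
  | inl (inl _), inl (inl _) | inl (inr _), inl (inr _) | inr _, inr _ => true
  | _, _ => false
  end.

Lemma conn_kind C A B : ~~ same_kind A B -> conn C A B = fun=> 0.
Proof. by case: A B C => [[?|?]|[? ?]] [[?|?]|[? ?]] [[?|?]|[? ?]]. Qed.

(** In each quadratic term of [RcompE] the intermediate index [A'] differs in kind from [A] or from
    [D], so one of the two factors vanishes. *)
Lemma Rcomp_kind D A B C e : ~~ same_kind A D -> Rcomp D A B C e = 0.
Proof.
move=> nAD; rewrite RcompE !(conn_kind _ nAD) !act_cst subrr add0r.
rewrite big1 ?sub0r ?big1 ?oppr0// => [C' _|A' _]; first by rewrite (conn_kind _ nAD) mulr0.
have [sAA|nAA] := boolP (same_kind A A'); last by rewrite !(conn_kind _ nAA) !mul0r subrr.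
suff nAD' : ~~ same_kind A' D by rewrite !(conn_kind _ nAD') !mulr0 subrr.
by case: A A' D nAD sAA => [[?|?]|[? ?]] [[?|?]|[? ?]] [[?|?]|[? ?]].
Qed.

Lemma pd_along_invariant f A e : (forall s : R, f (e + s *: natural_dir R A) = f e) -> pd A f e = 0.
Proof. exact: derive_invariant. Qed.

Lemma pd_time (f : 'rV[R]_p -> R) A e : (forall a, A <> it a) -> pd A (fun e' => f e'.1.1) e = 0.
Proof.
move=> nA; apply: pd_along_invariant => s; congr (f _).
by case: A nA => [[a|i]|[i a]] nA /=; [have := nA a| |]; rewrite /= ?scaler0 ?addr0.
Qed.

Lemma act_time (f : 'rV[R]_p -> R) A e :
  (forall a, A <> it a) -> act (frame A) (fun e' => f e'.1.1) e = 0.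
Proof.
move=> nA; rewrite /act sum_aindex /= big1 ?add0r => [|a _].
  by rewrite !big1 ?addr0// => v _; rewrite pd_time ?mulr0.
by case: A nA => [[b|i]|[i b]] nA /=; [have := nA b| |]; rewrite ?mul0r.
Qed.

(** By [Rcomp_kind] the trace runs over temporal indices only. There [conn B] vanishes, and
    [frame B] has no temporal component with which to differentiate [Hchr]. *)
Lemma Ric_time_nontime a B e : (forall b, B <> it b) -> Ric (it a) B e = 0.
Proof.
move=> nB; rewrite /Defs.Ric sum_aindex /=.
rewrite [X in _ + X + _]big1 ?[X in _ + X]big1 ?addr0 => [|*|*]; [|exact: Rcomp_kind..].
have conn0 (b c : 'I_p) : conn B (it b) (it c) = fun=> 0.
  by case: B nB => [[d|i]|[i d]] nB //; have := nB d.
apply: big1 => d _; rewrite RcompE conn0 act_cst sub0r (act_time (Hchr h d a d))//.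
rewrite oppr0 add0r sum_aindex /= !big1 ?addr0 ?sub0r ?oppr0// => [|v _|i _|c _].
(* In the bracket term only a temporal [C'] has a nonzero coefficient on temporal indices, and the
   bracket has no temporal component. *)
- move=> -[[c|i]|[i c]] _ /=; rewrite ?mulr0//.
  by rewrite (@bracket_frame_vertical _ _ (it c)) ?mul0r.
- by case: B {nB conn0} => [[?|?]|[? ?]]; case: v => ? ?; rewrite /= !mul0r subrr.
- by case: B {nB conn0} => [[?|?]|[? ?]]; rewrite /= !mul0r subrr.
- by rewrite !conn0 mul0r mulr0 subrr.
Qed.

End Frames.

(** * The divergence of the Einstein tensor *)

Section Divergence.
Context (R : realType) (p n : nat).
Local Notation J := (jcoord R p n).
Local Notation I := (aindex p n).
Context (h : 'rV[R]_p -> 'M[R]_p) (L : J -> R) (g : J -> 'M[R]_n).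
Implicit Types (A B C : I) (e : J) (f : J -> R).

Local Notation frame := (frame h L g).
Local Notation conn := (conn h L g).
Local Notation Ric := (Ric h L g).
Local Notation Sc := (Sc h L g).
Local Notation covd := (covd h L g).
Local Notation raise := (raise h g).
Local Notation divergence := (divergence h L g).
Local Notation ginv := (ginv g).
Local Notation hinv := (hinv h).

(* [emb] enumerates whole same-kind classes of adapted indices. *)
Definition kind_embedding (U : finType) (emb : U -> I) :=
  forall (u : U) (F : I -> R), (forall A, ~~ same_kind A (emb u) -> F A = 0) ->
    \sum_A F A = \sum_k F (emb k).

Lemma kind_embedding_it : kind_embedding (@it p n).
Proof.
move=> u F F0; rewrite sum_aindex [X in _ + X + _]big1
  ?[X in _ + X]big1 ?addr0// => *; exact: F0.
Qed.

Lemma kind_embedding_ix : kind_embedding (@ix p n).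
Proof.
move=> u F F0; rewrite sum_aindex [X in X + _ + _]big1
  ?[X in _ + X]big1 ?addr0 ?add0r// => *; exact: F0.
Qed.

Lemma kind_embedding_iv : kind_embedding (@iv p n).
Proof.
move=> u F F0; rewrite sum_aindex [X in X + _ + _]big1
  ?[X in _ + X + _]big1 ?add0r// => *; exact: F0.
Qed.

Lemma same_kindC A B : same_kind A B = same_kind B A.
Proof. by case: A B => [[?|?]|?] [[?|?]|?]. Qed.

Lemma covd_kind (U V : finType) (up : U -> I) (lo : V -> I) W C u l e :
  kind_embedding up -> kind_embedding lo ->
  covd id id W C (up u) (lo l) e = covd up lo (fun k m => W (up k) (lo m)) C u l e.
Proof.
move=> ku kl; rewrite /Defs.covd (ku u) ?(kl l)// => A nA.
  by rewrite conn_kind ?mul0r// same_kindC.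
by rewrite conn_kind ?mul0r.
Qed.

Lemma divergence_kind (V : finType) (lo : V -> I) W l e :
  kind_embedding lo ->
  divergence W (lo l) e =
    \sum_a covd it lo (fun k m => raise W (it k) (lo m)) (it a) a l e
  + \sum_i covd ix lo (fun k m => raise W (ix k) (lo m)) (ix i) i l e
  + \sum_v covd iv lo (fun k m => raise W (iv k) (lo m)) (iv v) v l e.
Proof.
move=> kl; rewrite /Defs.divergence sum_aindex.
congr (_ + _ + _); apply: eq_bigr => u _; apply: covd_kind => //.
- exact: kind_embedding_it.
- exact: kind_embedding_ix.
- exact: kind_embedding_iv.
Qed.

Lemma actZ X f (c : R) e : act X (fun e' => c * f e') e = c * act X f e.
Proof.
rewrite /act mulr_sumr; apply: eq_bigr => A _.
by rewrite /pd deriveZ_total mulrCA.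
Qed.

Lemma actN X f e : act X (fun e' => - f e') e = - act X f e.
Proof.
by rewrite -mulN1r -actZ; congr act; rewrite funeqE => e'; rewrite mulN1r.
Qed.

(** No derivability of [W] is required, thanks to [deriveZ_total]. This is how the Einstein constant
    leaves the divergence. *)
Lemma divergenceZ (c : R) W A e :
  divergence (fun B C e' => c * W B C e') A e = c * divergence W A e.
Proof.
rewrite /Defs.divergence mulr_sumr; apply: eq_bigr => B _.
have raiseZ C B' : raise (fun B C e' => c * W B C e') C B' = fun e' => c * raise W C B' e'.
  by rewrite funeqE => e'; rewrite /Defs.raise mulr_sumr; apply: eq_bigr => *; rewrite mulrCA.
rewrite /Defs.covd raiseZ actZ mulrBr mulrDr !mulr_sumr.
by congr (_ + _ - _); apply: eq_bigr => C _; rewrite raiseZ mulrCA.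
Qed.

Lemma Sc_split e : Sc e = Hscal h L g e + Rscal h L g e + Sscal h L g e.
Proof.
rewrite /Defs.Sc sum_aindex; congr (_ + _ + _).
- by apply: eq_bigr => a _; apply: (@kind_embedding_it a) => // -[[?|?]|[? ?]]//=; rewrite mul0r.
- by apply: eq_bigr => a _; apply: (@kind_embedding_ix a) => // -[[?|?]|[? ?]]//=; rewrite mul0r.
transitivity (\sum_(v : 'I_n * 'I_p) \sum_(w : 'I_n * 'I_p)
  h e.1.1 v.2 w.2 * ginv e v.1 w.1 * Ric (iv (v.1, v.2)) (iv (w.1, w.2)) e).
  apply: eq_bigr => -[i a] _; rewrite (@kind_embedding_iv (i, a)).
    by apply: eq_bigr => -[].
  by move=> -[[?|?]|[? ?]]//= _; rewrite mul0r.
rewrite -(pair_bigA _ (fun i a => \sum_w h e.1.1 a w.2 * ginv e i w.1 * Ric (iv (i, a)) (iv (w.1, w.2)) e)).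
rewrite exchange_big; apply: eq_bigr => a _ /=.
rewrite [RHS]exchange_big; apply: eq_bigr => i _ /=.
by rewrite -(pair_bigA _ (fun j b => h e.1.1 a b * ginv e i j * Ric (iv (i, a)) (iv (j, b)) e)) exchange_big.
Qed.

Lemma raise_it W m A e : raise W (it m) A e = \sum_c hinv e.1.1 m c * W (it c) A e.
Proof. by apply: (@kind_embedding_it m) => -[[?|?]|[? ?]]//=; rewrite mul0r. Qed.

Lemma raise_ix W i A e : raise W (ix i) A e = \sum_k ginv e i k * W (ix k) A e.
Proof. by apply: (@kind_embedding_ix i) => -[[?|?]|[? ?]]//=; rewrite mul0r. Qed.

Lemma raise_iv W v A e : raise W (iv v) A e =
  \sum_mu h e.1.1 v.2 mu * \sum_m ginv e v.1 m * W (iv (m, mu)) A e.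
Proof.
case: v => i a.
transitivity (\sum_(w : 'I_n * 'I_p) h e.1.1 a w.2 * ginv e i w.1 * W (iv (w.1, w.2)) A e).
  rewrite /Defs.raise (@kind_embedding_iv (i, a)); first by apply: eq_bigr => -[].
  by move=> -[[?|?]|[? ?]]//= _; rewrite mul0r.
rewrite -(pair_bigA _ (fun m mu => h e.1.1 a mu * ginv e i m * W (iv (m, mu)) A e)).
rewrite exchange_big; apply: eq_bigr => mu _ /=.
by rewrite mulr_sumr; apply: eq_bigr => m _; rewrite mulrA.
Qed.

(** The product is computed block by block. In the vertical block [h] and [hinv] exchange roles, so
    there [h] is multiplied by its inverse on the right. *)
Lemma Gpot_invK A B e : h e.1.1 \in unitmx -> g e \in unitmx ->
  \sum_C Gpot_inv h g A C e * Gpot h g C B e = (A == B)%:R.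
Proof.
move=> uh ug.
have mulVE m (M : 'M[R]_m) i j : M \in unitmx -> \sum_k invmx M i k * M k j = (i == j)%:R.
  by move=> /mulVmx/matrixP/(_ i j); rewrite !mxE.
have mulEV m (M : 'M[R]_m) i j : M \in unitmx -> \sum_k M i k * invmx M k j = (i == j)%:R.
  by move=> /mulmxV/matrixP/(_ i j); rewrite !mxE.
rewrite -/(raise (Gpot h g) A B e).
case: A => [[a|i]|[i a]]; [rewrite raise_it|rewrite raise_ix|rewrite raise_iv].
- by case: B => [[b|j]|[j b]] /=; rewrite ?mulVE// big1// => *; rewrite mulr0.
- by case: B => [[b|j]|[j b]] /=; rewrite ?mulVE// big1// => *; rewrite mulr0.
case: B => [[b|j]|[j b]] /=.
- by rewrite big1// => mu _; rewrite big1 ?mulr0// => *; rewrite mulr0.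
- by rewrite big1// => mu _; rewrite big1 ?mulr0// => *; rewrite mulr0.
under eq_bigr => mu _.
  under eq_bigr do rewrite mulrCA.
  rewrite -mulr_sumr mulVE// mulrA; over.
rewrite -mulr_suml mulEV// -natrM mulnb; congr (_%:R).
by rewrite andbC.
Qed.

Definition einstein_tensor A B e : R := Ric A B e - Sc e / 2 * Gpot h g A B e.

Lemma raise_einstein A B e : h e.1.1 \in unitmx -> g e \in unitmx ->
  raise einstein_tensor A B e = raise Ric A B e - Sc e / 2 * (A == B)%:R.
Proof.
move=> uh ug; rewrite -(Gpot_invK A B uh ug) mulr_sumr -sumrB.
by apply: eq_bigr => C _; rewrite mulrBr [in X in _ - X]mulrCA.
Qed.

(** * Localisation to an open domain *)

Section Domain.
Context (D : set J).
Context (oD : open D).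

(** Derivatives depend on germs only. Since [D] is open, identities known only on the chart domain
    can be used under [act] and [covd]. *)
Lemma act_local X f f' e : D e -> (forall e', D e' -> f e' = f' e') ->
  act X f e = act X f' e.
Proof.
move=> De ff; apply: eq_bigr => A _; congr (_ * _); apply: near_eq_derive.
by apply: filterS (open_nbhs_nbhs (conj oD De)) => e' /ff.
Qed.

Lemma act_local0 X f e : D e -> (forall e', D e' -> f e' = 0) -> act X f e = 0.
Proof. by move=> De f0; rewrite (act_local _ De f0) act_cst. Qed.

Lemma covd_local (U V : finType) (up : U -> I) (lo : V -> I) W W' C u l e : D e ->
  (forall k m e', D e' -> W k m e' = W' k m e') ->
  covd up lo W C u l e = covd up lo W' C u l e.
Proof.
move=> De WW; rewrite /Defs.covd (act_local _ De (WW u l)).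
by congr (_ + _ - _); apply: eq_bigr => k _; rewrite WW.
Qed.

Lemma covd_local0 (U V : finType) (up : U -> I) (lo : V -> I) W C u l e : D e ->
  (forall k m e', D e' -> W k m e' = 0) -> covd up lo W C u l e = 0.
Proof.
move=> De W0; rewrite (covd_local _ _ _ _ _ De (W' := fun _ _ _ => 0))// /Defs.covd act_cst.
by rewrite !big1 ?addr0 ?subr0// => *; rewrite mulr0.
Qed.

Lemma divergence_local W W' A e : D e -> (forall B C e', D e' -> W B C e' = W' B C e') ->
  divergence W A e = divergence W' A e.
Proof.
move=> De WW; apply: eq_bigr => B _; apply: covd_local => // C A' e' De'.
by apply: eq_bigr => B' _; rewrite WW.
Qed.

Context (hU : forall e, D e -> h e.1.1 \in unitmx) (gU : forall e, D e -> g e \in unitmx).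

(** The scalar curvature enters through a Kronecker delta, so it survives only in the block where
    both indices are of the same kind. *)
Lemma divergence_einstein_it b e : D e ->
  divergence einstein_tensor (it b) e =
    \sum_mu covd it it (fun m b' e' => H_tt h L g m b' e' - Sc e' / 2 * (m == b')%:R)
      (it mu) mu b e
  + \sum_m covd ix it (R_xt h L g) (ix m) m b e
  + \sum_v covd iv it (P_vt h L g) (iv v) v b e.
Proof.
move=> De; rewrite divergence_kind; last exact: kind_embedding_it.
by congr (_ + _ + _); apply: eq_bigr => u _; apply: covd_local => // k m e' De';
  rewrite raise_einstein ?hU ?gU// ?raise_it ?raise_ix ?raise_iv// mulr0 subr0.
Qed.

(** The sum over temporal indices is absent by [Ric_time_nontime]. *)
Lemma divergence_einstein_ix j e : D e ->
  divergence einstein_tensor (ix j) e =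
    \sum_m covd ix ix (fun m j' e' => R_xx h L g m j' e' - Sc e' / 2 * (m == j')%:R)
      (ix m) m j e
  + \sum_v covd iv ix (P_vx h L g) (iv v) v j e.
Proof.
move=> De; rewrite divergence_kind; last exact: kind_embedding_ix.
rewrite big1 ?add0r => [|a _].
  by congr (_ + _); apply: eq_bigr => u _; apply: covd_local => // k m e' De';
    rewrite raise_einstein ?hU ?gU// ?raise_it ?raise_ix ?raise_iv// mulr0 subr0.
apply: covd_local0 => // k m e' De'.
rewrite raise_einstein ?hU ?gU// mulr0 subr0 raise_it big1// => c _.
by rewrite Ric_time_nontime ?mulr0.
Qed.

Lemma divergence_einstein_iv w e : D e ->
  divergence einstein_tensor (iv w) e =
    \sum_m covd ix iv (P_xv h L g) (ix m) m w e
  + \sum_v covd iv iv (fun v' w' e' => S_vv h L g v' w' e' - Sc e' / 2 * (v' == w')%:R)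
      (iv v) v w e.
Proof.
move=> De; rewrite divergence_kind; last exact: kind_embedding_iv.
rewrite big1 ?add0r => [|a _].
  by congr (_ + _); apply: eq_bigr => u _; apply: covd_local => // k m e' De';
    rewrite raise_einstein ?hU ?gU// ?raise_it ?raise_ix ?raise_iv// mulr0 subr0.
apply: covd_local0 => // k m e' De'.
rewrite raise_einstein ?hU ?gU// mulr0 subr0 raise_it big1// => c _.
by rewrite Ric_time_nontime ?mulr0.
Qed.

End Domain.

End Divergence.

(** * Conservation laws in one chart *)

Section Laws.
Context (R : realType) (p n : nat).
Local Notation J := (jcoord R p n).
Local Notation I := (aindex p n).
Context (h : 'rV[R]_p -> 'M[R]_p) (L : J -> R) (g : J -> 'M[R]_n) (D : set J).
Implicit Types (A B C E : I) (e : J) (f : J -> R) (v w : 'I_n * 'I_p).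

Local Notation frame := (frame h L g).
Local Notation conn := (conn h L g).
Local Notation Rcomp := (Rcomp h L g).
Local Notation Ric := (Ric h L g).
Local Notation Sc := (Sc h L g).
Local Notation Hscal := (Hscal h L g).
Local Notation Rscal := (Rscal h L g).
Local Notation Sscal := (Sscal h L g).
Local Notation covd := (covd h L g).
Local Notation divergence := (divergence h L g).
Local Notation ginv := (ginv g).
Local Notation hinv := (hinv h).
Local Notation einstein_tensor := (einstein_tensor h L g).

Context (oD : open D) (hU : forall e, D e -> h e.1.1 \in unitmx)
  (gU : forall e, D e -> g e \in unitmx).

(** * The laws for one temporal dimension *)

Lemma single_time_laws e (o : 'I_p) : (forall a : 'I_p, a = o) -> D e ->
  (forall A, divergence einstein_tensor A e = 0) <-> laws_p1 h L g o e.
Proof.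
move=> all_o De.
have sum_o (F : 'I_p -> R) : \sum_a F a = F o.
  by rewrite (bigD1 o)//= big1 ?addr0// => a; rewrite (all_o a) eqxx.
have sum_vo (F : 'I_n * 'I_p -> R) : \sum_v F v = \sum_m F (m, o).
  rewrite (eq_bigr (fun v => F (v.1, v.2))) => [|[]//].
  by rewrite -(pair_bigA _ (fun m a => F (m, a))); apply: eq_bigr => m _; rewrite sum_o.
(* The only possible contribution has all four indices equal to [it o], and it vanishes by
   antisymmetry of the curvature. *)
have Ric0 e' : Ric (it o) (it o) e' = 0.
  rewrite /Defs.Ric sum_aindex sum_o Rcomp_diag add0r.
  by rewrite !big1 ?addr0// => *; rewrite Rcomp_kind.
have Sc2 e' : Sc e' = Rscal e' + Sscal e'.
  by rewrite Sc_split /Defs.Hscal !sum_o Ric0 mulr0 add0r.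
have ScE : Sc = fun e' => Rscal e' + Sscal e' by rewrite funeqE.
have -> : (forall A, divergence einstein_tensor A e = 0) <->
  [/\ divergence einstein_tensor (it o) e = 0,
      forall j, divergence einstein_tensor (ix j) e = 0 &
      forall j, divergence einstein_tensor (iv (j, o)) e = 0].
  split=> [H|[Ht Hx Hv] [[a|i]|[i a]]]; first by split.
  - by rewrite (all_o a).
  - exact: Hx.
  - by rewrite (all_o a); exact: Hv.
rewrite (divergence_einstein_it L oD hU gU)// sum_o sum_vo.
(* With a single temporal index the upper and lower corrections cancel, so the covariant derivative
   reduces to [act]. *)
set W := (X in covd it it X); have -> : covd it it W (it o) o o e =
    - act (frame (it o)) (fun e' => (Rscal e' + Sscal e') / 2) e.
  rewrite /Defs.covd !sum_o addrK -actN; congr act; rewrite funeqE => e'.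
  by rewrite /W /H_tt sum_o Ric0 mulr0 add0r eqxx mulr1 Sc2.
have laws j : (divergence einstein_tensor (ix j) e = 0 <->
        \sum_(m < n) covd ix ix
          (fun m' j' e' => R_xx h L g m' j' e' - (Rscal e' + Sscal e') / 2 * (m' == j')%:R)
          (ix m) m j e
        = - \sum_(m < n) covd iv ix (P_vx h L g) (iv (m, o)) (m, o) j e).
  rewrite (divergence_einstein_ix L oD hU gU)// sum_vo.
  rewrite ScE /=.
  by split=> [/eqP|->]; [rewrite addr_eq0 => /eqP|rewrite addNr].
have lawv j : (divergence einstein_tensor (iv (j, o)) e = 0 <->
        \sum_(m < n) covd iv iv
          (fun m' j' e' => S_vv h L g m' j' e' - (Rscal e' + Sscal e') / 2 * (m' == j')%:R)
          (iv (m, o)) (m, o) (j, o) e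
        = - \sum_(m < n) covd ix iv (P_xv h L g) (ix m) m (j, o) e).
  rewrite (divergence_einstein_iv L oD hU gU)// sum_vo addrC.
  rewrite ScE /=.
  by split=> [/eqP|->]; [rewrite addr_eq0 => /eqP|rewrite addNr].
rewrite -addrA; split=> -[Ht Hx Hv]; split.
- by apply/esym/eqP; rewrite -subr_eq0 addrC Ht.
- by move=> j; apply/laws.
- by move=> j; apply/lawv.
- by rewrite Ht addNr.
- by move=> j; apply/laws.
- by move=> j; apply/lawv.
Qed.

(** * The laws for a spatial metric constant along the fibres *)

Definition fibre_constant f := forall e, D e ->
  forall v (s : R), f (e + s *: natural_dir R (iv v)) = f e.

Context (Dv : forall e, D e -> forall v (s : R), D (e + s *: natural_dir R (iv v))).

Lemma vertical_shift_base e v (s : R) : (e + s *: natural_dir R (iv v)).1 = e.1.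
Proof. by case: v => i a; case: e => [[t x] y] /=; rewrite !scaler0 !addr0. Qed.

Lemma fibre_constant_time (f : 'rV[R]_p -> R) : fibre_constant (fun e => f e.1.1).
Proof. by move=> e _ v s; rewrite vertical_shift_base. Qed.

Lemma fibre_constant_cst (c : R) : fibre_constant (fun=> c).
Proof. by []. Qed.

(** Invariance under vertical shifts, unlike the vanishing of vertical derivatives, passes to sums
    and products pointwise, without derivability. *)
Lemma fibre_constantD f f' : fibre_constant f -> fibre_constant f' ->
  fibre_constant (fun e => f e + f' e).
Proof. by move=> cf cf' e De v s; rewrite (cf e De) (cf' e De). Qed.

Lemma fibre_constantB f f' : fibre_constant f -> fibre_constant f' ->
  fibre_constant (fun e => f e - f' e).
Proof. by move=> cf cf' e De v s; rewrite (cf e De) (cf' e De). Qed.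

Lemma fibre_constantM f f' : fibre_constant f -> fibre_constant f' ->
  fibre_constant (fun e => f e * f' e).
Proof. by move=> cf cf' e De v s; rewrite (cf e De) (cf' e De). Qed.

Lemma fibre_constant_sum (U : finType) (F : U -> J -> R) :
  (forall u, fibre_constant (F u)) -> fibre_constant (fun e => \sum_u F u e).
Proof. by move=> cF e De v s; apply: eq_bigr => u _; exact: cF. Qed.

Lemma pd_fibre_constant v f e : D e -> fibre_constant f -> pd (iv v) f e = 0.
Proof. by move=> De cf; apply: pd_along_invariant => s; exact: cf. Qed.

(** Differentiation commutes with translation, and [f] coincides with its vertical translate near
    [e]. *)
Lemma fibre_constant_pd A f : fibre_constant f -> fibre_constant (pd A f).
Proof.
move=> cf e De v s; rewrite /pd -derive_translate; apply: near_eq_derive.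
by apply: filterS (open_nbhs_nbhs (conj oD De)) => e' De'; exact: cf.
Qed.

Lemma act_vertical v f e : act (frame (iv v)) f e = pd (iv v) f e.
Proof. by rewrite /act sum_aindex /= sumr_delta !big1 ?add0r// => *; rewrite mul0r. Qed.

(** The nonlinear connection enters the frame only as coefficients of vertical derivatives, which
    kill [f]. The dependence of [Mconn] and [Nconn] on the fibre is therefore harmless. *)
Lemma act_fibre_constant A f e : D e -> fibre_constant f -> act (frame A) f e = pd A f e.
Proof.
move=> De cf; case: A => [[a|i]|v]; last exact: act_vertical.
  rewrite /act sum_aindex /= sumr_delta [X in _ + X + _]big1 ?[X in _ + X]big1 ?addr0//.
    by move=> v _; rewrite pd_fibre_constant ?mulr0.
  by move=> *; rewrite mul0r.
rewrite /act sum_aindex /= sumr_delta [X in X + _ + _]big1 ?[X in _ + X]big1 ?addr0 ?add0r//.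
  by move=> v _; rewrite pd_fibre_constant ?mulr0.
by move=> *; rewrite mul0r.
Qed.

Lemma fibre_constant_act A f : fibre_constant f -> fibre_constant (act (frame A) f).
Proof.
move=> cf e De v s; rewrite !act_fibre_constant//; last exact: Dv.
exact: fibre_constant_pd.
Qed.

Context (cg : forall i j, fibre_constant (fun e => g e i j)).

Lemma fibre_constant_ginv i j : fibre_constant (fun e => ginv e i j).
Proof.
move=> e De v s; rewrite /Defs.ginv; congr (invmx _ i j).
by apply/matrixP => k l; exact: cg.
Qed.

Lemma Ccoef0 i j k c e : D e -> Ccoef g i j k c e = 0.
Proof.
by move=> De; rewrite /Ccoef big1// => m _; rewrite !pd_fibre_constant// addr0 subr0 mulr0.
Qed.

Lemma conn_vertical0 v A B e : D e -> conn (iv v) A B e = 0.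
Proof.
move=> De; case: v A B => [j c] [[?|?]|[? ?]] [[?|?]|[? ?]] //=; first exact: Ccoef0.
by rewrite Ccoef0 ?mulr0.
Qed.

Lemma fibre_constant_Gcoef k j c : fibre_constant (Gcoef h L g k j c).
Proof.
move=> e De v s; apply: eq_bigr => i _; congr (_ / _ * _).
  exact: fibre_constant_ginv.
exact/fibre_constant_act/De/cg.
Qed.

Lemma fibre_constant_Lcoef i j k : fibre_constant (Lcoef h L g i j k).
Proof.
move=> e De v s; apply: eq_bigr => m _; congr (_ / _ * (_ + _ - _)).
- exact: fibre_constant_ginv.
- exact/fibre_constant_act/De/cg.
- exact/fibre_constant_act/De/cg.
- exact/fibre_constant_act/De/cg.
Qed.

Lemma fibre_constant_conn C A B : fibre_constant (conn C A B).
Proof.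
case: C => [[c|k]|u]; last by move=> e De v s; rewrite !conn_vertical0//; exact: Dv.
- case: A => [[a|i]|[i a]]; case: B => [[b|j]|[j b]]; try exact: fibre_constant_cst.
  + exact: (fibre_constant_time (Hchr h b a c)).
  + exact: fibre_constant_Gcoef.
  + exact: (fibre_constantB
      (fibre_constantM (fibre_constant_cst _) (fibre_constant_Gcoef _ _ _))
      (fibre_constantM (fibre_constant_cst _) (fibre_constant_time (Hchr h a b c)))).
- case: A => [[a|i]|[i a]]; case: B => [[b|j]|[j b]]; try exact: fibre_constant_cst.
  + exact: fibre_constant_Lcoef.
  + exact: (fibre_constantM (fibre_constant_cst _) (fibre_constant_Lcoef _ _ _)).
Qed.

(** The bracket term of [RcompE] drops out: brackets have only vertical components, and the vertical
    connection coefficients are zero. *)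
Lemma Rcomp_fibre_constant E A B C e : D e -> Rcomp E A B C e =
  act (frame C) (conn B A E) e - act (frame B) (conn C A E) e
  + \sum_A' (conn B A A' e * conn C A' E e - conn C A A' e * conn B A' E e).
Proof.
move=> De; rewrite RcompE [X in _ - X]big1 ?subr0// => -[b|v] _; last first.
  by rewrite conn_vertical0 ?mulr0.
by rewrite bracket_frame_vertical ?mul0r.
Qed.

Lemma Rcomp_vertical0 E A B v e : D e -> Rcomp E A B (iv v) e = 0.
Proof.
move=> De; rewrite (Rcomp_fibre_constant _ _ _ _ De) act_vertical.
rewrite (pd_fibre_constant _ De (fibre_constant_conn _ _ _)).
rewrite (act_local0 oD _ De) => [|e' De']; last exact: conn_vertical0.
rewrite subrr add0r big1// => A' _.
by rewrite (conn_vertical0 _ _ _ De) (conn_vertical0 _ _ _ De) mul0r mulr0 subrr.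
Qed.

Lemma Rcomp_vertical0l E A C v e : D e -> Rcomp E A (iv v) C e = 0.
Proof.
move=> De; rewrite (Rcomp_fibre_constant _ _ _ _ De) act_vertical.
rewrite (pd_fibre_constant _ De (fibre_constant_conn _ _ _)).
rewrite (act_local0 oD _ De) => [|e' De']; last exact: conn_vertical0.
rewrite subrr add0r big1// => A' _.
by rewrite (conn_vertical0 _ _ _ De) (conn_vertical0 _ _ _ De) mul0r mulr0 subrr.
Qed.

Lemma fibre_constant_Ric A B : fibre_constant (Ric A B).
Proof.
move=> e De v s; apply: eq_bigr => E _.
rewrite (Rcomp_fibre_constant _ _ _ _ De) (Rcomp_fibre_constant _ _ _ _ (Dv De v s)).
have ca X Y : fibre_constant (act (frame X) (conn Y A E)).
  exact/fibre_constant_act/fibre_constant_conn.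
have cc X Y : fibre_constant (fun e => \sum_A'
    (conn X A A' e * conn Y A' E e - conn Y A A' e * conn X A' E e)).
  apply: fibre_constant_sum => A'.
  exact: (fibre_constantB
    (fibre_constantM (fibre_constant_conn _ _ _) (fibre_constant_conn _ _ _))
    (fibre_constantM (fibre_constant_conn _ _ _) (fibre_constant_conn _ _ _))).
exact: (fibre_constantD (fibre_constantB (ca _ _) (ca _ _)) (cc _ _) De).
Qed.

Lemma Ric_vertical_r A v e : D e -> Ric A (iv v) e = 0.
Proof. by move=> De; rewrite /Defs.Ric big1// => E _; exact: Rcomp_vertical0l. Qed.

(** By [Rcomp_kind] the traced index must be vertical too, and then it also occupies the last slot
    of the curvature. *)
Lemma Ric_vertical_l v B e : D e -> Ric (iv v) B e = 0.
Proof.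
move=> De; rewrite /Defs.Ric big1// => -[b|w] _; last exact: Rcomp_vertical0.
by apply: Rcomp_kind; case: v; case: b.
Qed.

Lemma Sc_fibre_constant e : D e -> Sc e = Hscal e + Rscal e.
Proof.
move=> De; rewrite Sc_split [X in _ + X]big1 ?addr0// => a _; rewrite big1// => b _.
by rewrite big1// => i _; rewrite big1// => j _; rewrite Ric_vertical_l ?mulr0.
Qed.

Lemma fibre_constant_HR : fibre_constant (fun e => Hscal e + Rscal e).
Proof.
apply: fibre_constantD; apply: fibre_constant_sum => a; apply: fibre_constant_sum => b.
  exact: (fibre_constantM (fibre_constant_time (fun t => hinv t a b)) (fibre_constant_Ric _ _)).
exact: (fibre_constantM (fibre_constant_ginv _ _) (fibre_constant_Ric _ _)).
Qed.

Lemma fibre_constant_laws e : D e ->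
  (forall A, divergence einstein_tensor A e = 0) <-> laws_p2 h L g e.
Proof.
move=> De.
have divt b : divergence einstein_tensor (it b) e =
     \sum_(mu < p) covd it it
       (fun m' b' e' => H_tt h L g m' b' e' - (Hscal e' + Rscal e') / 2 * (m' == b')%:R)
       (it mu) mu b e
     + \sum_(m < n) covd ix it (R_xt h L g) (ix m) m b e.
  rewrite (divergence_einstein_it L oD hU gU)// [X in _ + X]big1 ?addr0 => [|v _].
    congr (_ + _); apply: eq_bigr => m _; apply: (covd_local _ _ _ oD) => // k l e' De'.
    by rewrite Sc_fibre_constant.
  apply: (covd_local0 _ _ _ oD) => // k l e' De'; rewrite /P_vt big1// => mu _.
  by rewrite big1 ?mulr0// => m _; rewrite Ric_vertical_l ?mulr0.
have divx j : divergence einstein_tensor (ix j) e =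
     \sum_(m < n) covd ix ix
       (fun m' j' e' => R_xx h L g m' j' e' - (Hscal e' + Rscal e') / 2 * (m' == j')%:R)
       (ix m) m j e.
  rewrite (divergence_einstein_ix L oD hU gU)// [X in _ + X]big1 ?addr0 => [|v _].
    apply: eq_bigr => m _; apply: (covd_local _ _ _ oD) => // k l e' De'.
    by rewrite Sc_fibre_constant.
  apply: (covd_local0 _ _ _ oD) => // k l e' De'; rewrite /P_vx big1// => mu _.
  by rewrite big1 ?mulr0// => m _; rewrite Ric_vertical_l ?mulr0.
have divv w : divergence einstein_tensor (iv w) e = 0.
  rewrite (divergence_einstein_iv L oD hU gU)// big1 ?add0r => [|m _]; last first.
    apply: (covd_local0 _ _ _ oD) => // k l e' De'; rewrite /P_xv big1// => i _.
    by rewrite Ric_vertical_r ?mulr0.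
  apply: big1 => v _.
  (* The Ricci part of the vertical block vanishes. What remains is [Sc / 2] times a delta, written
     as a product with a constant to fit [fibre_constantM]. *)
  rewrite (covd_local _ _ _ oD _ _ _ _ _ De
    (W' := fun v' w' e' => (Hscal e' + Rscal e') * - (2^-1 * (v' == w')%:R))); last first.
    move=> k l e' De'; rewrite Sc_fibre_constant// /S_vv big1 ?sub0r ?mulrN ?mulrA// => mu _.
    by rewrite big1 ?mulr0// => i _; rewrite Ric_vertical_l ?mulr0.
  have cW : fibre_constant (fun e' => (Hscal e' + Rscal e') * - (2^-1 * (v == w)%:R)).
    exact: (fibre_constantM fibre_constant_HR (fibre_constant_cst _)).
  rewrite /Defs.covd act_vertical (pd_fibre_constant _ De cW) add0r.
  by rewrite !big1 ?subrr// => k _; rewrite (conn_vertical0 _ _ _ De) mul0r.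
split=> [H|[Ht Hx] [[b|j]|w]].
- split=> [b|j]; last by rewrite -divx.
  by apply/eqP; rewrite -addr_eq0 -divt H.
- by rewrite divt Ht addNr.
- by rewrite divx.
- exact: divv.
Qed.

End Laws.

(** * Kronecker regularity *)

Lemma smooth_derive_comm (R : realType) (V : normedModType R) (D : set V) (f : V -> R) x u v :
  open D -> smooth_on D f -> D x -> 'D_v ('D_u f) x = 'D_u ('D_v f) x.
Proof.
move=> oD sf Dx; have [_ f1] := sf 2.
have [fu [_ fu1]] := f1 u; have [fv [_ fv1]] := f1 v.
have [fuv [cuv _]] := fu1 v; have [fvu [cvu _]] := fv1 u.
apply: (derive_comm oD Dx) => [y Dy||]; [split|exact: cuv|exact: cvu].
- exact: fu.
- exact: fv.
- exact: fuv.
- exact: fvu.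
Qed.

Lemma smooth_derive (R : realType) (V W : normedModType R) (D : set V) (f : V -> W) u :
  smooth_on D f -> smooth_on D (fun x => 'D_u f x).
Proof. by move=> sf k; have [_ /(_ u)[]] := sf k.+1. Qed.

(** A congruence preserves invertibility, and the diagonal entries are 1 or -1. *)
Lemma unitmx_has_signature (R : realType) (d : nat) (A : 'M[R]_d) (r : nat) :
  has_signature A r -> A \in unitmx.
Proof.
case=> P uP ->; rewrite !unitmx_mul unitmx_tr uP andbT /= unitmxE det_diag unitfE.
by apply/prodf_neq0 => i _; rewrite mxE; case: ifP; rewrite ?oppr_eq0 oner_neq0.
Qed.

Lemma open_jet_dom (R : realType) (p n : nat) (T : manifold R p) (M : manifold R n)
    (a : mchart T) (b : mchart M) : open (jet_dom a b).
Proof.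
apply: openI.
  apply: (@open_comp _ _ (fun e : jcoord R p n => e.1.1)); last exact: m_open_range.
  by move=> e _; apply: continuous_comp; exact: cvg_fst.
apply: (@open_comp _ _ (fun e : jcoord R p n => e.1.2)); last exact: m_open_range.
by move=> e _; apply: continuous_comp; [exact: cvg_fst|exact: cvg_snd].
Qed.

Lemma jet_dom_vertical_shift (R : realType) (p n : nat) (T : manifold R p) (M : manifold R n)
    (a : mchart T) (b : mchart M) e :
  jet_dom a b e -> forall v (s : R), jet_dom a b (e + s *: natural_dir R (iv v)).
Proof. by case=> ? ? v s; split; rewrite vertical_shift_base. Qed.

Section KroneckerRegular.
Context (R : realType) (p n : nat).
Local Notation J := (jcoord R p n).
Context (h : 'rV[R]_p -> 'M[R]_p) (L : J -> R) (g : J -> 'M[R]_n) (D : set J).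
Context (oD : open D) (hU : forall e, D e -> h e.1.1 \in unitmx)
  (Dv : forall e, D e -> forall v (s : R), D (e + s *: natural_dir R (iv v)))
  (sL : smooth_on D L) (sg : smooth_on D g)
  (reg : forall e, D e -> forall i j al be,
     pd (iv (i, al)) (pd (iv (j, be)) L) e / 2 = hinv h e.1.1 al be * g e i j).

(* Both sides are half of the third vertical derivative of [L], which is symmetric. *)
Lemma hinv_pd_swap e i j k al be ga : D e ->
  hinv h e.1.1 al be * pd (iv (k, ga)) (fun e' => g e' i j) e =
  hinv h e.1.1 ga be * pd (iv (i, al)) (fun e' => g e' k j) e.
Proof.
move=> De.
(* Along the vertical line, which stays in [D], the factor [hinv] is constant, so Kronecker
   regularity can be differentiated there. *)
have third i' j' al' k' ga' : hinv h e.1.1 al' be * pd (iv (k', ga')) (fun e' => g e' i' j') e =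
    2^-1 * pd (iv (k', ga')) (pd (iv (i', al')) (pd (iv (j', be)) L)) e.
  rewrite /pd -!deriveZ_total; apply: derive_eq_line => s.
  have := reg (Dv De (k', ga') s) i' j' al' be.
  by rewrite vertical_shift_base mulrC => <-.
apply: etrans (third i j al k ga) (etrans _ (esym (third k j ga i al))).
exact: (congr1 ( *%R 2^-1) (smooth_derive_comm (natural_dir R (iv (i, al)))
  (natural_dir R (iv (k, ga))) oD (smooth_derive (natural_dir R (iv (j, be))) sL) De)).
Qed.

Lemma pd_vertical_metric0 e i j v : (2 <= p)%N -> D e -> pd (iv v) (fun e' => g e' i j) e = 0.
Proof.
move=> p2 De; case: v => k ga.
have [al neq] : exists al : 'I_p, ga != al.
  have p0 : (0 < p)%N by apply: ltn_trans p2.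
  have [->|] := eqVneq ga (Ordinal p0); first by exists (Ordinal p2).
  by exists (Ordinal p0).
have mulVE (c : 'I_p) : \sum_be hinv h e.1.1 c be * h e.1.1 be al = (c == al)%:R.
  by have /mulVmx/matrixP/(_ c al) := hU De; rewrite !mxE.
(* The factor 1 is expanded as a contraction of [hinv] with [h]. After the swap the same contraction
   gives [ga == al], which is false. *)
suff : (al == al)%:R * pd (iv (k, ga)) (fun e' => g e' i j) e = 0 by rewrite eqxx mul1r.
rewrite -mulVE mulr_suml.
under eq_bigr => be _ do rewrite mulrAC (hinv_pd_swap i j k al be ga De) mulrAC.
by rewrite -mulr_suml mulVE (negbTE neq) mul0r.
Qed.

(** Each vertical line lies entirely in [D], so on it the entry is a function on all of [R] with
    zero derivative. *)
Lemma fibre_constant_metric i j : (2 <= p)%N -> fibre_constant D (fun e => g e i j).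
Proof.
move=> p2 e De v s.
have dg0 r : is_derive r (1 : R) (fun r' : R => g (e + r' *: natural_dir R (iv v)) i j) 0.
  have De' := Dv De v r.
  rewrite -(pd_vertical_metric0 i j v p2 De').
  apply: (is_derive_line (f := fun e' => g e' i j)).
  apply: (derivable_mxP _ _ _).1.
  by have [_ /(_ (natural_dir R (iv v)))[dg _]] := sg 1; exact: dg.
by rewrite (is_derive_0_is_cst s 0 dg0) scale0r addr0.
Qed.

End KroneckerRegular.

(** * The theorem, chart by chart *)

Theorem theorem4p4 (R : realType) (p n : nat) (T : manifold R p) (M : manifold R n)
    (h : mchart T -> 'rV[R]_p -> 'M[R]_p)
    (L : mchart T -> mchart M -> jcoord R p n -> R)
    (g : mchart T -> mchart M -> jcoord R p n -> 'M[R]_n)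
    (K : R)
    (Tm : mchart T -> mchart M -> aindex p n -> aindex p n -> jcoord R p n -> R)
    (h_metric : semi_riemannian h)
    (L_space : lagrange_space h L g)
    (Tm_tensor : dtensor02 Tm)
    (einstein : forall a b e, jet_dom a b e -> forall A B,
       Ric (h a) (L a b) (g a b) A B e
       - Sc (h a) (L a b) (g a b) e / 2 * Gpot (h a) (g a b) A B e
       = K * Tm a b A B e) :
  let conservation := forall a b e, jet_dom a b e -> forall A,
    divergence (h a) (L a b) (g a b) (Tm a b) A e = 0 in
  let formulas_p1 := forall a b e, jet_dom a b e -> forall o : 'I_p,
    laws_p1 (h a) (L a b) (g a b) o e in
  let formulas_p2 := forall a b e, jet_dom a b e ->
    laws_p2 (h a) (L a b) (g a b) e in
  (p = 1%N ->
     (conservation -> formulas_p1) /\ (K != 0 -> formulas_p1 -> conservation)) /\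
  ((2 <= p)%N ->
     (conservation -> formulas_p2) /\ (K != 0 -> formulas_p2 -> conservation)).
Proof.
move=> conservation formulas_p1 formulas_p2.
have [_ _ [rh h_sig] _] := h_metric.
have [[sL _] reg [sg _] g_nondeg _] := L_space.
have oD (a : mchart T) (b : mchart M) : open (jet_dom a b) by exact: open_jet_dom.
have hU a (b : mchart M) e : jet_dom a b e -> h a e.1.1 \in unitmx.
  by move=> [De _]; exact: unitmx_has_signature (h_sig _ _ De).
have gU a b e : jet_dom a b e -> g a b e \in unitmx.
  by move=> /g_nondeg[_ rk]; rewrite -row_free_unit /row_free rk.
(* The Einstein equations hold on the whole open chart domain, so their divergence can be taken. *)
have divK a b e A : jet_dom a b e ->
    divergence (h a) (L a b) (g a b) (einstein_tensor (h a) (L a b) (g a b)) A e =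
    K * divergence (h a) (L a b) (g a b) (Tm a b) A e.
  move=> De; rewrite -divergenceZ; apply: (divergence_local _ _ _ (oD a b)) => // B C e' De'.
  exact: einstein.
have cons_to a b e : conservation -> jet_dom a b e -> forall A,
    divergence (h a) (L a b) (g a b) (einstein_tensor (h a) (L a b) (g a b)) A e = 0.
  by move=> cons De A; rewrite divK// cons// mulr0.
(* The converse direction divides by [K]. *)
have to_cons : K != 0 -> (forall a b e, jet_dom a b e -> forall A,
    divergence (h a) (L a b) (g a b) (einstein_tensor (h a) (L a b) (g a b)) A e = 0) -> conservation.
  move=> K0 div0 a b e De A; apply: (mulfI K0).
  by rewrite mulr0 -divK// div0.
split=> [p1|p2].
  have one (o a : 'I_p) : a = o by subst p; rewrite !ord1.
  have equiv a b e o : jet_dom a b e -> _ :=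
    @single_time_laws _ _ _ (h a) (L a b) (g a b) _ (oD a b) (hU a b) (gU a b) e o (one o).
  split=> [cons a b e De o|K0 laws].
    by apply/equiv => //; exact: cons_to.
  apply: to_cons => // a b e De.
  have p0 : (0 < p)%N by rewrite p1.
  by apply/(equiv a b e (Ordinal p0) De); exact: laws.
have shift a b := @jet_dom_vertical_shift R p n T M a b.
have g_fibre a b i j := fibre_constant_metric (oD a b) (hU a b) (shift a b)
  (sL a b) (sg a b) (reg a b) i j p2.
have equiv a b e : jet_dom a b e -> _ :=
  @fibre_constant_laws _ _ _ (h a) (L a b) (g a b) _ (oD a b) (hU a b) (gU a b)
    (shift a b) (g_fibre a b) e.
split=> [cons a b e De|K0 laws].
  by apply/equiv => //; exact: cons_to.
by apply: to_cons => // a b e De; apply/equiv => //; exact: laws.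
Qed.
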